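(* Let $k\ge 1$ be an integer and let $z_1,\dots,z_k,q$ be complex numbers with $|q|<1$. For integers $m\ge 0$ let $$F(m)=\sum_{m_1+m_2+\cdots+m_k=m}\frac{z_1^{m_1}q^{(m_1^2+m_1)/2}\,z_2^{m_2}q^{(m_2^2+m_2)/2}\cdots z_k^{m_k}q^{(m_k^2+m_k)/2}}{(q)_{m_1}(q)_{m_2}\cdots(q)_{m_k}},$$ where $m_1,\dots,m_k$ range over non-negative integers (so that $F(0)=1$), and let $F(m)=0$ for negative integers $m$. Then for all positive integers $m$, $$F(m)=\frac{q^m}{1-q^m}\sum_{n=1}^{k}S_n^k(z_1,z_2,\dots,z_k)\,F(m-n).$$
   Context: $(q)_n:=\prod_{j=1}^{n}(1-q^j)$ for $n\ge 0$ (so $(q)_0=1$). $S_n^k(z_1,\dots,z_k):=\sum_{1\le i_1<\cdots<i_n\le k}z_{i_1}\cdots z_{i_n}$ is the elementary symmetric polynomial of degree $n$ in $z_1,\dots,z_k$. Convention $0^0=1$. *)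

(* Defs.v *)
From mathcomp Require Import all_boot all_order all_algebra.
From mathcomp Require Export reals complex.
From mathcomp Require mpoly.

Set Implicit Arguments.
Unset Strict Implicit.
Unset Printing Implicit Defensive.

Import GRing.Theory.
Local Open Scope ring_scope.

Definition qpoch (K : fieldType) (q : K) (n : nat) : K :=
  \prod_(1 <= j < n.+1) (1 - q ^+ j).

(* [mpoly.mesym k K n] is the elementary symmetric polynomial of degree [n]
   in [k] variables. *)
Definition elemsym (K : fieldType) (k : nat) (z : 'I_k -> K) (n : nat) : K :=
  mpoly.meval z (mpoly.mesym k K n).

(* The [m_i] are non-negative with sum [n], so each is at most [n]; hence the
   index set of finite functions into ['I_n.+1].  The division by 2 is exact. *)
Definition F (K : fieldType) (k : nat) (z : 'I_k -> K) (q : K) (m : int) : K :=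
  match m with
  | Posz n =>
      \sum_(f : {ffun 'I_k -> 'I_n.+1} | (\sum_i f i)%N == n)
        \prod_(i < k)
          (z i ^+ f i * q ^+ ((f i ^ 2 + f i) %/ 2)%N / qpoch q (f i))
  | Negz _ => 0
  end.

(* Main.v *)
Require Import Defs.
From mathcomp Require Import all_boot all_order all_algebra.
From mathcomp Require Import reals complex.
From mathcomp Require Import ring zify.
Import GRing.Theory Num.Theory.
Local Open Scope ring_scope.

(** The recurrence is the coefficientwise form of a q-difference equation.
    Put a_n(z) = z^n q^(n(n+1)/2) / (q)_n.  The generating series
    A_z(X) = sum_n a_n(z) X^n is, by Euler, the product of the 1 + z q^j X over
    j >= 1, and so satisfies A_z(X) = ((1 + z X) A_z)(q X)
    ([coef_euler_poly_functional]).  By definition F(m) is the coefficient of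
    X^m in G = A_(z_1) ... A_(z_k).  Substituting X -> q X is multiplicative,
    so G(X) = (E G)(q X), where E = (1 + z_1 X) ... (1 + z_k X) has the
    elementary symmetric polynomials as coefficients
    ([coef_prod_elemsym]).  Comparing coefficients of X^m gives
    F(m) = q^m sum_(n >= 0) e_n F(m - n)  ([F_convolution]);
    moving the term n = 0 to the left and dividing by 1 - q^m, which is nonzero
    because |q| < 1, gives the theorem.

    Power series are replaced by their truncations at a degree N, and equality
    by agreement of the coefficients up to N, which is stable under products
    ([eq_upto_prod]).  *)

(** * Polynomials agreeing up to a given degree *)

Definition eq_upto (K : fieldType) (N : nat) (p r : {poly K}) : Prop :=
  forall j, (j <= N)%N -> p`_j = r`_j.

Lemma eq_upto_prod (K : fieldType) (N : nat) (I : finType)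
    (p r : I -> {poly K}) :
  (forall i, eq_upto K N (p i) (r i)) ->
  eq_upto K N (\prod_i p i) (\prod_i r i).
Proof.
move=> eq_pr; apply: (big_ind2 (eq_upto K N)) => // p1 r1 p2 r2 eq1 eq2 j le_jN.
rewrite !coefM; apply: eq_bigr => i _.
rewrite eq1 ?eq2 //; first exact: leq_trans (leq_subr _ _) le_jN.
by apply: leq_trans le_jN; rewrite -ltnS.
Qed.

Lemma coef_comp_scaleX (K : fieldType) (q : K) (p : {poly K}) (n : nat) :
  (p \Po (q *: 'X))`_n = q ^+ n * p`_n.
Proof.
rewrite comp_polyE coef_sum -[in RHS](coefK p) coef_poly.
rewrite (eq_bigr (fun i : 'I_(size p) =>
  if (i : nat) == n then q ^+ n * p`_n else 0)) => [|i _]; last first.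
  rewrite exprZn scalerA coefZ coefXn eq_sym.
  by case: eqP => [->|_]; rewrite ?mulr1 ?mulr0 // mulrC.
rewrite -big_mkcond /=; case: ltnP => [lt_n|ge_n].
  by rewrite (big_pred1 (Ordinal lt_n)).
rewrite mulr0 big_pred0 // => i; apply/negbTE.
by rewrite neq_ltn (leq_trans (ltn_ord i) ge_n).
Qed.

(** * Euler's series *)

Definition euler_coef (K : fieldType) (q z : K) (n : nat) : K :=
  z ^+ n * q ^+ ((n ^ 2 + n) %/ 2)%N / qpoch q n.

Lemma euler_coef0 (K : fieldType) (q z : K) : euler_coef K q z 0 = 1.
Proof. by rewrite /euler_coef /qpoch big_geq // invr1 !mulr1. Qed.

(** Passing from n to n + 1 adds n + 1 to the exponent n(n+1)/2, which is the
    factor q^(n+1) here, and puts 1 - q^(n+1) in the denominator. *)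
Lemma euler_coefS (K : fieldType) (q z : K) (n : nat) :
  q ^+ n.+1 != 1 ->
  (1 - q ^+ n.+1) * euler_coef K q z n.+1 = q ^+ n.+1 * (z * euler_coef K q z n).
Proof.
move=> q_neq1; have nz: 1 - q ^+ n.+1 != 0 by rewrite subr_eq0 eq_sym.
have expE: ((n.+1 ^ 2 + n.+1) %/ 2 = n.+1 + (n ^ 2 + n) %/ 2)%N.
  rewrite -divnMDl //; congr (_ %/ _)%N.
  by lia.
rewrite /euler_coef expE /qpoch big_nat_recr //= exprD [z ^+ _]exprS invfM.
by rewrite mulrCA [_^-1 / _]mulrC mulVKf //; ring.
Qed.

Definition euler_poly (K : fieldType) (q : K) (N : nat) (z : K) : {poly K} :=
  \poly_(j < N.+1) euler_coef K q z j.

Lemma eq_upto_euler_poly (K : fieldType) (q z : K) (M N : nat) :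
  (M <= N)%N -> eq_upto K M (euler_poly K q M z) (euler_poly K q N z).
Proof.
by move=> le_MN j le_jM; rewrite !coef_poly !ltnS le_jM (leq_trans le_jM).
Qed.

Lemma coef_euler_poly_functional (K : fieldType) (q z : K) (N : nat) :
  (forall n, q ^+ n.+1 != 1) ->
  eq_upto K N (euler_poly K q N z)
    (((1 + z *: 'X) * euler_poly K q N z) \Po (q *: 'X)).
Proof.
move=> q_neq1 [|j] le_jN; rewrite coef_comp_scaleX mulrDl mul1r coefD -scalerAl
  coefZ coefXM !coef_poly //=.
  by rewrite euler_coef0 mulr0 addr0 mulr1.
rewrite !ltnS le_jN (ltnW le_jN) mulrDr -euler_coefS //.
by rewrite mulrBl mul1r addrC subrK.
Qed.

(** * Coefficients of the products *)

(** The truncation at N and the index set ['I_N.+1] of the expanded product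
    match exactly, so for N = n this is a sum over the index set defining
    [F z q n]; larger N give the same coefficient. *)
Lemma coef_prod_euler_poly (K : fieldType) (k : nat) (z : 'I_k -> K) (q : K)
    (N n : nat) :
  (n <= N)%N -> (\prod_(i < k) euler_poly K q N (z i))`_n = F z q n%:Z.
Proof.
move=> le_nN.
rewrite -(eq_upto_prod K n _ (fun i => euler_poly K q n (z i))) //; last first.
  by move=> i; apply: eq_upto_euler_poly.
under eq_bigr do rewrite /euler_poly poly_def.
rewrite bigA_distr_bigA coef_sum /= [RHS]big_mkcond /=.
apply: eq_bigr => f _; rewrite scaler_prod prodrXr coefZ coefXn eq_sym.
by case: eqP; rewrite ?mulr1 ?mulr0.
Qed.

Lemma coef_prod_elemsym (K : fieldType) (k : nat) (z : 'I_k -> K) (n : nat) :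
  (\prod_(i < k) (1 + z i *: 'X))`_n = elemsym z n.
Proof.
under eq_bigr do rewrite addrC.
rewrite bigA_distr coef_sum /elemsym mpoly.mesymE (big_morph _ (mpoly.mevalD z) (mpoly.meval0 z)) [RHS]big_mkcond /=.
apply: eq_bigr => J _; rewrite -big_mkcond /= scaler_prod prodr_const.
rewrite coefZ coefXn eq_sym.
case: eqP => _; rewrite ?mulr1 ?mulr0 // mpoly.mevalX big_mkcond /=.
by apply: eq_bigr => i _; rewrite mpoly.mnmE; case: (i \in J).
Qed.

Lemma elemsym_gt (K : fieldType) (k : nat) (z : 'I_k -> K) (n : nat) :
  (k < n)%N -> elemsym z n = 0.
Proof.
move=> lt_kn; rewrite /elemsym mpoly.mesymE big_pred0 ?mpoly.meval0 // => J.
apply/negbTE; rewrite neq_ltn (leq_ltn_trans _ lt_kn) //.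
by rewrite -[k in (_ <= k)%N]card_ord max_card.
Qed.

(** * The recurrence *)

Lemma F_convolution (K : fieldType) (k : nat) (z : 'I_k -> K) (q : K)
    (m : nat) :
  (forall n, q ^+ n.+1 != 1) ->
  F z q m%:Z = q ^+ m * \sum_(0 <= n < k.+1) elemsym z n * F z q (m%:Z - n%:Z).
Proof.
move=> q_neq1.
rewrite -(coef_prod_euler_poly K k z q m m) //.
rewrite (eq_upto_prod K m _ _ _
  (fun i => coef_euler_poly_functional K q (z i) m q_neq1)) //.
rewrite -rmorph_prod /= coef_comp_scaleX big_split coefM /=; congr (_ * _).
pose t n := elemsym z n * F z q (m%:Z - n%:Z).
transitivity (\sum_(0 <= n < m.+1) t n).
  rewrite big_mkord; apply: eq_bigr => -[n le_nm] _ /=.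
  by rewrite /t coef_prod_elemsym coef_prod_euler_poly ?leq_subr // subzn.
(* For n > k the elementary symmetric polynomial vanishes, for n > m it is
   F(m - n) that does: both ranges extend to n <= max(k, m). *)
rewrite [LHS](big_nat_widen _ _ (maxn k m).+1) ?ltnS ?leq_maxr //.
rewrite [RHS](big_nat_widen _ _ (maxn k m).+1) ?ltnS ?leq_maxl //.
rewrite [LHS]big_mkcond [RHS]big_mkcond.
apply: eq_big_nat => n _; rewrite -/(t n) /= !ltnS.
case: (leqP n m) => [le_nm|lt_mn]; case: leqP => // lt_kn.
  by rewrite /t elemsym_gt ?mul0r.
rewrite /t -opprB subzn 1?ltnW //.
by move: lt_mn; rewrite -subn_gt0; case: (n - m)%N => // d _; rewrite mulr0.
Qed.

Theorem theorem6p7 (R : realType) (k : nat) (hk : (1 <= k)%N)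
    (z : 'I_k -> R[i]) (q : R[i]) (hq : `|q| < 1) (m : nat) (hm : (0 < m)%N) :
  F z q m%:Z =
    q ^+ m / (1 - q ^+ m) *
    \sum_(1 <= n < k.+1) elemsym z n * F z q (m%:Z - n%:Z).
Proof.
have q_neq1 n : q ^+ n.+1 != 1.
  apply/eqP => /(congr1 Num.norm); rewrite normrX normr1 => /eqP.
  by rewrite Order.POrderTheory.lt_eqF // exprn_ilt1.
have nz: 1 - q ^+ m != 0 by rewrite subr_eq0 eq_sym -(prednK hm).
have e0: elemsym z 0 = 1.
  by rewrite /elemsym mpoly.mesym0E mpoly.meval1.
have := F_convolution _ _ z q m q_neq1.
rewrite big_ltn // e0 mul1r subr0 mulrDr addrC => /eqP.
rewrite -subr_eq -{1}[F z q m]mul1r -mulrBl => /eqP eqF.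
by apply: (mulfI nz); rewrite eqF mulrAC [RHS]mulrC divfK.
Qed.
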